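(* Let $p\in\mathbb{N}$, $j=\begin{bmatrix} I_p & 0\\ 0 & -I_p\end{bmatrix}$, and let $\{C_k\}_{k\ge 0}$ be $2p\times 2p$ complex matrices such that $C_k>0$ and $C_k\, j\, C_k=j$ for all $k\ge 0$. For $\lambda\in\mathbb{C}\setminus\{0\}$ let $\{W_k(\lambda)\}_{k\ge 0}$ be the fundamental solution of the discrete Dirac system determined by $\{C_k\}$, normalised at $k=0$, that is, the $2p\times 2p$ matrices given by $$W_0(\lambda)= I_{2p},\qquad W_{k+1}(\lambda)=\Big(I_{2p}-\frac{\mathrm{i}}{\lambda}\,j\,C_k\Big)W_k(\lambda)\quad (k\ge 0).$$ Then for every integer $N\ge 0$ and all $\lambda,\mu\in\mathbb{C}\setminus\{0\}$ with $\lambda\neq\mu$ and $1+\lambda\mu\neq 0$, $$\sum_{k=0}^{N}c(\lambda,\mu)^k\,W_k(\overline{\mu})^*\,C_k\,W_k(\lambda)=\mathrm{i}\,\frac{1+\lambda\mu}{\mu-\lambda}\Big(c(\lambda,\mu)^{N+1}\,W_{N+1}(\overline{\mu})^*\,j\,W_{N+1}(\lambda)-j\Big),$$ where $$c(\lambda,\mu)=\frac{\lambda\mu}{1+\lambda\mu}.$$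
   Context: $I_m$ is the $m\times m$ identity matrix, $\mathrm{i}$ is the imaginary unit, $\overline{\mu}$ is the complex conjugate of $\mu$, $A^*$ is the conjugate transpose of the matrix $A$, and $C>0$ means that $C$ is (Hermitian) positive definite. The (self-adjoint) discrete Dirac system is $y_{k+1}(\lambda)=\big(I_{2p}-\frac{\mathrm{i}}{\lambda}jC_k\big)y_k(\lambda)$, $k\ge 0$, with $C_k>0$ and $C_kjC_k=j$. *)

(* Defs.v *)
From HB Require Import structures.
From mathcomp Require Import all_boot all_order all_algebra.
From mathcomp Require Import sesquilinear spectral.
From mathcomp Require Export complex.
From mathcomp Require Export reals.

Set Implicit Arguments.
Unset Strict Implicit.
Unset Printing Implicit Defensive.

Import Order.TTheory GRing.Theory Num.Theory Num.Def.
Local Open Scope ring_scope.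
Local Open Scope sesquilinear_scope.

(* In a numClosedFieldType, 0 < z forces z to be real. *)
Definition posdefmx (F : numClosedFieldType) (n : nat) (A : 'M[F]_n) : Prop :=
  A \is hermsymmx /\
  forall v : 'cV[F]_n, v != 0 -> 0 < ((v ^t*) *m A *m v) 0 0.

Definition jmx (F : numClosedFieldType) (p : nat) : 'M[F]_(p + p) :=
  block_mx 1%:M 0 0 (- 1%:M).

Arguments jmx {F p}.

(* Only meaningful for lambda != 0, since 0^-1 = 0 in MathComp. *)
Fixpoint dirac_W (F : numClosedFieldType) (p : nat)
    (C : nat -> 'M[F]_(p + p)) (lambda : F) (k : nat) : 'M[F]_(p + p) :=
  if k is k'.+1
  then (1%:M - ('i / lambda) *: (jmx *m C k')) *m dirac_W C lambda k'
  else 1%:M.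

Definition cfactor (F : numClosedFieldType) (lambda mu : F) : F :=
  lambda * mu / (1 + lambda * mu).

(* Main.v *)
Require Import Defs.
From HB Require Import structures.
From mathcomp Require Import all_boot all_order all_algebra.
From mathcomp Require Import sesquilinear spectral complex reals.
From mathcomp Require Import ring.

(** The identity is a telescoping sum.  Let
    [S k = c ^ k W_k(conj mu)^* j W_k(lambda)], so that [S 0 = j].  The claim is
    that the [k]-th summand on the left equals
    [i (1 + lambda mu) / (mu - lambda)] times [S (k + 1) - S k].

    The step factor of [W(conj mu)^*] is
    [(1 - (i / conj mu) j C)^* = 1 + (i / mu) C j], because [C] and [j] are
    Hermitian.  Expanding with [j^2 = 1] and [C j C = j] gives
    [(1 + (i/mu) C j) j (1 - (i/lambda) j C)
       = (1 + 1/(lambda mu)) j + i (1/mu - 1/lambda) C]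
    ([dirac_step_form]).  The first coefficient is exactly [1 / c], which is
    why the weights [c ^ k] make the [j] terms cancel in [S (k + 1) - S k];
    what is left is a scalar multiple of the summand ([dirac_increment]). *)

Set Implicit Arguments.
Unset Strict Implicit.
Unset Printing Implicit Defensive.

Import Order.TTheory GRing.Theory Num.Theory Num.Def.
Local Open Scope ring_scope.
Local Open Scope sesquilinear_scope.

Section DiracIdentity.
Variables (F : numClosedFieldType) (p : nat).
Implicit Types (C : 'M[F]_(p + p)) (l m : F).

Lemma jmx_sqr : jmx *m jmx = 1%:M :> 'M[F]_(p + p).
Proof.
rewrite /jmx mulmx_block !mulmx0 !mul0mx !addr0 !add0r mulmx1.
by rewrite mulNmx mulmxN mulmx1 opprK -scalar_mx_block.
Qed.

Lemma jmx_adjoint : jmx ^t* = jmx :> 'M[F]_(p + p).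
Proof.
rewrite /jmx tr_block_mx map_block_mx !trmx0 !map_mx0 linearN /= trmx1.
by rewrite raddfN /= map_mx1.
Qed.

Lemma adjointM n q r (A : 'M[F]_(n, q)) (B : 'M[F]_(q, r)) :
  (A *m B) ^t* = B ^t* *m A ^t*.
Proof. by rewrite trmx_mul map_mxM. Qed.

Lemma posdefmx_adjoint C : posdefmx C -> C ^t* = C.
Proof. by case=> /is_hermitianmxP; rewrite expr0 scale1r => <-. Qed.

(** Evaluating at [m^*] and then taking the adjoint conjugates [m] twice, so
    the result depends on [m] without conjugation. *)
Lemma dirac_step_adjoint C m : C ^t* = C ->
  (1%:M - ('i / m^*) *: (jmx *m C)) ^t* = 1%:M + ('i / m) *: (C *m jmx).
Proof.
move=> Cherm; rewrite linearB /= linearZ /= trmx1 map_mxB map_mx1 map_mxZ.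
rewrite adjointM Cherm jmx_adjoint rmorphM fmorphV /= conjCK conjCi.
by rewrite mulNr scaleNr opprK.
Qed.

Lemma dirac_step_form C l m : C *m jmx *m C = jmx ->
  (1%:M + ('i / m) *: (C *m jmx)) *m jmx *m (1%:M - ('i / l) *: (jmx *m C))
  = (1 + (l * m)^-1) *: jmx + ('i * (m^-1 - l^-1)) *: C.
Proof.
move=> CjC.
rewrite mulmxDl mul1mx -scalemxAl -(mulmxA C) jmx_sqr mulmx1.
rewrite mulmxBr mulmx1 -scalemxAr mulmxA mulmxDl jmx_sqr -scalemxAl.
rewrite mulmxDl mul1mx -scalemxAl CjC scalerDr scalerA.
have -> : 'i / l * ('i / m) = - (l * m)^-1.
  by rewrite mulrACA -expr2 sqrCi -invfM mulN1r.
rewrite scaleNr mulrBr !(scalerDl, scalerBl) scale1r.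
by rewrite opprB addrACA -scaleNr.
Qed.

(** This is [S (k + 1) - S k] divided by [c ^ k].  In terms of the step form,
    the [j] part is [c (1 + 1/(lambda mu)) - 1 = 0], and the [C] part carries
    the coefficient [i c (1/mu - 1/lambda)]. *)
Lemma dirac_increment (C : nat -> 'M[F]_(p + p)) l m k :
  l != 0 -> m != 0 -> 1 + l * m != 0 ->
  C k ^t* = C k -> C k *m jmx *m C k = jmx ->
  cfactor l m *: (dirac_W C m^* k.+1 ^t* *m jmx *m dirac_W C l k.+1)
    - dirac_W C m^* k ^t* *m jmx *m dirac_W C l k
  = ('i * ((l - m) / (1 + l * m))) *:
      (dirac_W C m^* k ^t* *m C k *m dirac_W C l k).
Proof.
move=> l0 m0 lm0 Cherm CjC; rewrite /= adjointM dirac_step_adjoint //.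
set V := dirac_W C m^* k ^t*; set W := dirac_W C l k.
have -> : V *m (1%:M + ('i / m) *: (C k *m jmx)) *m jmx *m
    ((1%:M - ('i / l) *: (jmx *m C k)) *m W) =
    V *m ((1%:M + ('i / m) *: (C k *m jmx)) *m jmx *m
          (1%:M - ('i / l) *: (jmx *m C k))) *m W by rewrite !mulmxA.
rewrite dirac_step_form // mulmxDr mulmxDl -!scalemxAr -!scalemxAl.
rewrite scalerDr !scalerA.
(* The weight is the inverse of the coefficient that one step puts on [j]. *)
have -> : cfactor l m * (1 + (l * m)^-1) = 1.
  by rewrite /cfactor; field; rewrite lm0 l0 m0.
rewrite scale1r addrC addKr; congr (_ *: _).
by rewrite /cfactor; field; rewrite lm0 l0 m0.
Qed.

End DiracIdentity.

Theorem theorem3p1 (R : realType) (p : nat) (C : nat -> 'M[R[i]]_(p + p))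
  (C_pos : forall k : nat, posdefmx (C k))
  (C_j : forall k : nat, C k *m jmx *m C k = jmx)
  (N : nat) (lambda mu : R[i])
  (lambda_neq0 : lambda != 0) (mu_neq0 : mu != 0)
  (lambda_neq_mu : lambda != mu) (lambda_mu : 1 + lambda * mu != 0) :
  \sum_(0 <= k < N.+1)
     cfactor lambda mu ^+ k *:
       ((dirac_W C (mu^*) k ^t*) *m C k *m dirac_W C lambda k)
  = ('i * ((1 + lambda * mu) / (mu - lambda))) *:
      (cfactor lambda mu ^+ N.+1 *:
         ((dirac_W C (mu^*) N.+1 ^t*) *m jmx *m dirac_W C lambda N.+1)
       - jmx).
Proof.
set c := cfactor lambda mu.
pose S k := c ^+ k *: (dirac_W C (mu^*) k ^t* *m jmx *m dirac_W C lambda k).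
have S0 : S 0%N = jmx by rewrite /S scale1r /= trmx1 map_mx1 mul1mx mulmx1.
rewrite -[X in _ *: (X - _)]/(S N.+1) -[X in _ *: (_ - X)]S0 -telescope_sumr // scaler_sumr.
apply: eq_bigr => k _.
have Cherm := posdefmx_adjoint (C_pos k).
have -> : S k.+1 - S k = c ^+ k *:
    (c *: (dirac_W C mu^* k.+1 ^t* *m jmx *m dirac_W C lambda k.+1)
     - dirac_W C mu^* k ^t* *m jmx *m dirac_W C lambda k).
  by rewrite /S exprSr scalerBr !scalerA.
rewrite dirac_increment // !scalerA; congr (_ *: _).
have lm_neq0 : mu - lambda != 0 by rewrite subr_eq0 eq_sym.
(* The scalar in front of the sum is inverse to that of the increment. *)
have -> : 'i * ((1 + lambda * mu) / (mu - lambda))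
    * (c ^+ k * ('i * ((lambda - mu) / (1 + lambda * mu))))
    = - ('i ^+ 2) * c ^+ k.
  by field; rewrite lambda_mu.
by rewrite sqrCi opprK mul1r.
Qed.
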